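(* There is a distributed algorithm that, for every graph $G$, every fragmentation $\mathcal{F}=(F,G_f)$ of $G$ with fragment graph $G_f=(V_f,E_f)$, and every reachability query $q_r(s,t)$ with nodes $s,t$ of $G$, correctly decides whether $s$ can reach $t$ in $G$, and does so (a) in $O(|V_f|\,|F_m|)$ time, where $F_m$ is the largest fragment in $F$; (b) by visiting each site only once; and (c) with total network traffic bounded by $O(|V_f|^2)$.
   Context: **Graphs.** A graph $G=(V,E,L)$ has a finite node set $V$, directed edges $E\subseteq V\times V$, and a labeling $L:V\to\Sigma$ of the nodes by labels from a set $\Sigma$. A path from $v$ to $w$ is a node sequence $(v=v_0,v_1,\dots,v_n=w)$ with $(v_{i-1},v_i)\in E$ for all $i\in[1,n]$. Node $v$ can reach $w$ iff there is a path from $v$ to $w$. **Fragmentation.** A fragmentation of $G$ is a pair $\mathcal{F}=(F,G_f)$. Here $F=(F_1,\dots,F_k)$, and each fragment is $F_i=(V_i\cup F_i.O,\ E_i\cup cE_i,\ L_i)$, where: - $(V_1,\dots,V_k)$ is an (arbitrary) partition of $V$; - $(V_i,E_i,L_i)$ is the subgraph of $G$ induced by $V_i$; - $F_i.O$ (the virtual nodes of $F_i$) is the set of nodes $v\notin V_i$ such that $(u,v)\in E$ for some $u\in V_i$; - $cE_i$ (the cross edges) is the set of all edges $(u,v)\in E$ with $u\in V_i$ and $v\in F_i.O$. The in-nodes $F_i.I$ are the nodes $u\in V_i$ such that $(v,u)\in E$ for some $v$ in another $V_j$, $j\ne i$. The fragment graph is $G_f=(V_f,E_f)$ with $V_f=\bigcup_i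 (F_i.O\cup F_i.I)$ and $E_f=\bigcup_i cE_i$. The size $|F_i|$ is the number of nodes plus the number of edges of $F_i$, and $F_m$ is a fragment of maximum size. **Distributed model.** Fragment $F_i$ is stored at site $S_i$. A coordinator site $S_c$ receives the query and knows which fragment is at which site, as well as $G_f$. It posts the query to the sites (a site is visited each time it is contacted in this way). The sites compute locally and in parallel and ship data back to the coordinator, which computes the answer. Time means response time: the maximum over sites of the local computation time, plus the computation time at the coordinator. Network traffic is the total amount of data shipped from one site to another, where the size of the query $q_r(s,t)$ is regarded as negligible.
   Formalization: When no edge crosses fragments, V_f is empty and the literal bounds O(|V_f||F_m|) and O(|V_f|^2) are 0, which no algorithm can meet; the formal statement reads |V_f| as max(1,|V_f|), giving O(|F_m|) time and O(1) traffic in that case. *)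

(* Defs.v *)
(* MathComp world. *)
From mathcomp Require Import all_boot.
Set Implicit Arguments.
Unset Strict Implicit.
Unset Printing Implicit Defensive.

(* ---------------------------------------------------------------------- *)
(* Graphs and fragmentations                                              *)
(* ---------------------------------------------------------------------- *)

Record graph (Sigma : Type) := Graph {
  node :> finType;
  edges : {set node * node};
  label : node -> Sigma
}.

Definition edge (Sigma : Type) (G : graph Sigma) : rel G :=
  [rel u v | (u, v) \in edges G].

Record fragmentation (Sigma : Type) (G : graph Sigma) := Fragmentation {
  nfrag : nat;
  part : 'I_nfrag -> {set G};
  part_neq0 : forall i, part i != set0;
  part_disjoint : forall i j, i != j -> [disjoint part i & part j];
  part_cover : \bigcup_i part i = [set: G]
}.

Section Fragments.
Variables (Sigma : Type) (G : graph Sigma) (F : fragmentation G).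
Implicit Type i : 'I_(nfrag F).

Definition virtual_nodes i : {set G} :=
  [set v | (v \notin part i) && [exists u in part i, edge u v]].

Definition in_nodes i : {set G} :=
  [set u in part i | [exists j, (j != i) && [exists v in part j, edge v u]]].

Definition inner_edges i : {set G * G} :=
  [set e in edges G | (e.1 \in part i) && (e.2 \in part i)].

Definition cross_edges i : {set G * G} :=
  [set e in edges G | (e.1 \in part i) && (e.2 \in virtual_nodes i)].

Definition frag_nodes i : {set G} := part i :|: virtual_nodes i.
Definition frag_edges i : {set G * G} := inner_edges i :|: cross_edges i.
Definition frag_size i : nat := #|frag_nodes i| + #|frag_edges i|.
Definition max_frag_size : nat := \max_i frag_size i.

Definition Vf : {set G} := \bigcup_i (virtual_nodes i :|: in_nodes i).
Definition Ef : {set G * G} := \bigcup_i cross_edges i.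

End Fragments.

(* ---------------------------------------------------------------------- *)
(* Local computation: a unit-cost random access machine                   *)
(* ---------------------------------------------------------------------- *)

(* A program has finitely many registers and finitely many arrays, all
   initially zero apart from the input.  The only arithmetic is successor and
   predecessor, so after n steps no word exceeds the largest input word or
   program constant by more than n.  In polynomial time words therefore keep
   logarithmic length, and it is meaningful to charge one unit per operation
   and per word shipped: large data cannot be packed into a single word. *)

Inductive expr :=
| Cst of nat
| Reg of nat
| Get of nat & expr            (* Get a e is the cell e of the array a *)
| Inc of expr
| Dec of expr
| Eq of expr & expr
| Lt of expr & expr.

Inductive cmd :=
| Skip
| Assign of nat & expr           (* register assignment *)
| Put of nat & expr & expr     (* Put a e e' stores e' in the cell e of a *)
| Send of expr                 (* append a word to the outgoing message *)
| Post of expr                 (* contact the site with the given number *)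
| PostAll                      (* contact every site *)
| Seq of cmd & cmd
| If of expr & cmd & cmd       (* a nonzero value counts as true *)
| While of expr & cmd.

Record state := State {
  reg : nat -> nat;
  arr : nat -> nat -> nat;
  out : seq nat;
  posts : nat -> bool
}.

Definition upd (T : Type) (f : nat -> T) (x : nat) (y : T) : nat -> T :=
  fun z => if z == x then y else f z.

Fixpoint eval (st : state) (e : expr) : nat :=
  match e with
  | Cst n => n
  | Reg x => reg st x
  | Get a e1 => arr st a (eval st e1)
  | Inc e1 => (eval st e1).+1
  | Dec e1 => (eval st e1).-1
  | Eq e1 e2 => eval st e1 == eval st e2
  | Lt e1 e2 => eval st e1 < eval st e2
  end.

Fixpoint ecost (e : expr) : nat :=
  match e with
  | Cst _ | Reg _ => 1
  | Get _ e1 | Inc e1 | Dec e1 => (ecost e1).+1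
  | Eq e1 e2 | Lt e1 e2 => (ecost e1 + ecost e2).+1
  end.

Definition set_reg st x n := State (upd (reg st) x n) (arr st) (out st) (posts st).
Definition set_arr st a i n :=
  State (reg st) (upd (arr st) a (upd (arr st a) i n)) (out st) (posts st).
Definition set_out st w := State (reg st) (arr st) w (posts st).
Definition set_posts st p := State (reg st) (arr st) (out st) p.

(* exec c st st' n: started in st, the program c terminates in st' after n
   steps. *)
Inductive exec : cmd -> state -> state -> nat -> Prop :=
| ExecSkip st : exec Skip st st 1
| ExecAssign x e st :
    exec (Assign x e) st (set_reg st x (eval st e)) (ecost e).+1
| ExecPut a e e' st :
    exec (Put a e e') st (set_arr st a (eval st e) (eval st e'))
         (ecost e + ecost e').+1
| ExecSend e st :
    exec (Send e) st (set_out st (rcons (out st) (eval st e))) (ecost e).+1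
| ExecPost e st :
    exec (Post e) st (set_posts st (upd (posts st) (eval st e) true)) (ecost e).+1
| ExecPostAll st :
    exec PostAll st (set_posts st xpredT) 1
| ExecSeq c1 c2 st st1 st2 n1 n2 :
    exec c1 st st1 n1 -> exec c2 st1 st2 n2 ->
    exec (Seq c1 c2) st st2 (n1 + n2)
| ExecIfT e c1 c2 st st' n :
    eval st e != 0 -> exec c1 st st' n ->
    exec (If e c1 c2) st st' (ecost e + n).+1
| ExecIfF e c1 c2 st st' n :
    eval st e = 0 -> exec c2 st st' n ->
    exec (If e c1 c2) st st' (ecost e + n).+1
| ExecWhileT e c st st1 st2 n1 n2 :
    eval st e != 0 -> exec c st st1 n1 -> exec (While e c) st1 st2 n2 ->
    exec (While e c) st st2 (ecost e + n1 + n2).+1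
| ExecWhileF e c st :
    eval st e = 0 -> exec (While e c) st st (ecost e).+1.

(* The table l is stored under the name x as its length, in register x, and
   its items, in array x. *)
Definition set_tab (x : nat) (l : seq nat) (st : state) : state :=
  State (upd (reg st) x (size l)) (upd (arr st) x (nth 0 l)) (out st) (posts st).

Definition blank : state :=
  State (fun=> 0) (fun _ _ => 0) [::] xpred0.

(* ---------------------------------------------------------------------- *)
(* Distributed algorithms                                                 *)
(* ---------------------------------------------------------------------- *)

Definition tab_query := 0.
Definition tab_inbox := 1.
Definition tab_id := 2.
Definition tab_nodes := 3.
Definition tab_sources := 4.
Definition tab_targets := 5.
Definition tab_virtual := 6.
Definition tab_in := 7.
Definition reg_answer := 8.

(* All sites run the same program on their own data; neither program depends
   on the graph, the fragmentation or the query. *)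
Record algorithm := Algorithm { coord_prog : cmd; site_prog : cmd }.

Record outcome (k : nat) := Outcome {
  answer : bool;
  time : nat;
  visits : {ffun 'I_k -> nat};
  traffic : nat
}.

(* A message replaces the inbox of its addressee and clears its outgoing
   buffer; all other memory persists between visits. *)
Definition receive (w : seq nat) (st : state) : state :=
  set_posts (set_out (set_tab tab_inbox w st) [::]) xpred0.

Section Runs.
Variables (A : algorithm) (k : nat) (query : seq nat).

(* The coordinator computes, and thereby selects the set P of sites to be
   contacted.  If P is empty it has finished, and its answer is in reg_answer.
   Otherwise every site of P receives the query together with the outgoing
   message of the coordinator; the sites of P compute in parallel; and their
   replies, concatenated, become the next inbox of the coordinator.  A Post or
   PostAll executed by a site has no effect.  The words shipped in either
   direction count as traffic, the query does not.  If there is only one such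
   round, then time is the maximum of the local times plus the time spent by
   the coordinator; further rounds would be charged one after the other. *)
Inductive run : state -> {ffun 'I_k -> state} -> outcome k -> Prop :=
| RunHalt cst sst cst' tc :
    exec (coord_prog A) cst cst' tc ->
    [set i : 'I_k | posts cst' i] = set0 ->
    run cst sst (Outcome (reg cst' reg_answer != 0) tc [ffun=> 0] 0)
| RunRound cst (sst : {ffun 'I_k -> state}) cst' tc (P : {set 'I_k})
    (sst' : {ffun 'I_k -> state}) (ts : {ffun 'I_k -> nat}) o :
    exec (coord_prog A) cst cst' tc ->
    P = [set i : 'I_k | posts cst' i] ->
    P != set0 ->
    (forall i, i \in P ->
       exec (site_prog A)
            (receive (out cst') (set_tab tab_query query (sst i)))
            (sst' i) (ts i)) ->
    (forall i, i \notin P -> sst' i = sst i /\ ts i = 0) ->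
    run (receive (flatten [seq out (sst' i) | i <- enum P]) cst') sst' o ->
    run cst sst
      (Outcome (answer o)
               (tc + \max_(i in P) ts i + time o)
               [ffun i => (i \in P) + visits o i]
               (#|P| * size (out cst') + \sum_(i in P) size (out (sst' i))
                + traffic o)).

End Runs.

Section Inputs.
Variables (Sigma : Type) (G : graph Sigma) (F : fragmentation G).

Definition nid (v : G) : nat := enum_rank v.

Definition nodes_tab (A : {set G}) : seq nat := [seq nid v | v <- enum A].
Definition sources_tab (E : {set G * G}) : seq nat := [seq nid e.1 | e <- enum E].
Definition targets_tab (E : {set G * G}) : seq nat := [seq nid e.2 | e <- enum E].

Definition query_tab (s t : G) : seq nat := [:: nid s; nid t].

(* Labels play no role for reachability and are withheld from the programs. *)
Definition site_input (i : 'I_(nfrag F)) : state :=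
  set_tab tab_id [:: val i]
  (set_tab tab_nodes (nodes_tab (part i))
  (set_tab tab_sources (sources_tab (frag_edges i))
  (set_tab tab_targets (targets_tab (frag_edges i))
  (set_tab tab_virtual (nodes_tab (virtual_nodes i))
  (set_tab tab_in (nodes_tab (in_nodes i)) blank))))).

(* The fragment i is the one at site i, so that the coordinator needs only the
   number of sites and the fragment graph. *)
Definition coord_input (s t : G) : state :=
  set_tab tab_query (query_tab s t)
  (set_tab tab_id [:: nfrag F]
  (set_tab tab_nodes (nodes_tab (Vf F))
  (set_tab tab_sources (sources_tab (Ef F))
  (set_tab tab_targets (targets_tab (Ef F)) blank)))).

Definition evaluates (A : algorithm) (s t : G) (o : outcome (nfrag F)) : Prop :=
  run A (query_tab s t) (coord_input s t) [ffun i => site_input i] o.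

End Inputs.

Lemma exec_det c st st1 st2 n1 n2 :
  exec c st st1 n1 -> exec c st st2 n2 -> st1 = st2 /\ n1 = n2.
Proof.
move=> H; elim: H st2 n2 => {c st st1 n1}
  [st|x e st|a e e' st|e st|e st|st|c1 c2 st s1 s2 n1 n2 _ IH1 _ IH2
  |e c1 c2 st s1 n1 h _ IH|e c1 c2 st s1 n1 h _ IH
  |e c st s1 s2 n1 n2 h _ IH1 _ IH2|e c st h] st' n' H';
  inversion H'; subst => //;
  repeat match goal with
  | IH : forall _ _, exec ?c ?s _ _ -> _, K : exec ?c ?s _ _ |- _ =>
      case: (IH _ _ K) => ? ?; subst; clear IH
  end => //; by [match goal with
  | h : is_true (eval ?s ?e != 0), h' : eval ?s ?e = 0 |- _ => rewrite h' in h
  end].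
Qed.

Lemma run_det A k query cst sst (o1 o2 : outcome k) :
  run A query cst sst o1 -> run A query cst sst o2 -> o1 = o2.
Proof.
move=> H; elim: H o2 => {cst sst o1}
  [cst sst cst' tc Hc P0|cst sst cst' tc P sst' ts o Hc -> P0 Hs Hn _ IH] o2 H2.
- inversion H2 as [? ? c2 tc2 Hc2 P2|? ? c2 tc2 P s2 ts2 o Hc2 PE P2]; subst.
    by case: (exec_det Hc Hc2) => ? ?; subst.
  by case: (exec_det Hc Hc2) => ? ?; subst; rewrite P0 eqxx in P2.
inversion H2 as [? ? c2 tc2 Hc2 P2|? ? c2 tc2 P' s2 ts2 o' Hc2 PE P2 Hs2 Hn2 Hr]; subst.
  by case: (exec_det Hc Hc2) => ? ?; subst; rewrite P2 eqxx in P0.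
case: (exec_det Hc Hc2) => ? ?; subst.
have E i : sst' i = s2 i /\ ts i = ts2 i.
  case: (boolP (i \in [set i : 'I_k | posts c2 i])) => Pi.
    exact: exec_det (Hs i Pi) (Hs2 i Pi).
  by case: (Hn i Pi) => -> ->; case: (Hn2 i Pi) => -> ->.
have Es : sst' = s2 by apply/ffunP => i; case: (E i).
have Et : ts = ts2 by apply/ffunP => i; case: (E i).
by subst; rewrite (IH _ Hr).
Qed.

(* Main.v *)
(* Each site receives the query once.  From each of its in-nodes, and from s if
   it owns s, it runs a depth-first search of its fragment and sends the pairs
   (u, v) for which v is t or a virtual node reached from u.  The coordinator
   collects these pairs as the edges of a graph and searches it from s: a path
   from s to t in G splits at the cross edges into local pieces, each of which
   is one of the pairs.  As the in-nodes of different sites are distinct, there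
   are at most |V_f| + 1 sources overall; each of them contributes at most
   |V_f| + 1 pairs and, by the linear time of a search over linked adjacency
   lists, O(|F_m|) steps. *)
Require Import Defs.
From mathcomp Require Import all_boot zify.
Set Implicit Arguments.
Unset Strict Implicit.
Unset Printing Implicit Defensive.

(** * Syntactic frame conditions *)

Fixpoint written_regs (c : cmd) : seq nat :=
  match c with
  | Assign x _ => [:: x]
  | Seq c1 c2 | If _ c1 c2 => written_regs c1 ++ written_regs c2
  | While _ c1 => written_regs c1
  | _ => [::]
  end.

Fixpoint written_arrs (c : cmd) : seq nat :=
  match c with
  | Put a _ _ => [:: a]
  | Seq c1 c2 | If _ c1 c2 => written_arrs c1 ++ written_arrs c2
  | While _ c1 => written_arrs c1
  | _ => [::]
  end.

Fixpoint silent (c : cmd) : bool :=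
  match c with
  | Send _ => false
  | Seq c1 c2 | If _ c1 c2 => silent c1 && silent c2
  | While _ c1 => silent c1
  | _ => true
  end.

Fixpoint postless (c : cmd) : bool :=
  match c with
  | Post _ | PostAll => false
  | Seq c1 c2 | If _ c1 c2 => postless c1 && postless c2
  | While _ c1 => postless c1
  | _ => true
  end.

(** Lets a loop invariant mention only the memory that the loop body writes; the rest is recovered
    from the syntax of the body. *)
Definition frame (c : cmd) (st st' : state) : Prop :=
  [/\ forall x, x \notin written_regs c -> reg st' x = reg st x,
      forall a, a \notin written_arrs c -> arr st' a = arr st a,
      silent c -> out st' = out st
    & postless c -> posts st' = posts st].

Lemma frame_refl c st : frame c st st.
Proof. by []. Qed.

Lemma frame_trans c st1 st2 st3 :
  frame c st1 st2 -> frame c st2 st3 -> frame c st1 st3.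
Proof.
move=> [r1 a1 o1 p1] [r2 a2 o2 p2]; split=> [x h|x h|h|h].
- by rewrite r2 // r1.
- by rewrite a2 // a1.
- by rewrite o2 // o1.
by rewrite p2 // p1.
Qed.

Lemma frame_sub c c' st st' :
  {subset written_regs c <= written_regs c'} ->
  {subset written_arrs c <= written_arrs c'} ->
  (silent c' -> silent c) -> (postless c' -> postless c) ->
  frame c st st' -> frame c' st st'.
Proof.
move=> sr sa so sp [r a o p]; split=> [x h|x h|h|h].
- by apply: r; apply: contra h => /sr.
- by apply: a; apply: contra h => /sa.
- by apply/o/so.
by apply/p/sp.
Qed.

Lemma exec_frame c st st' n : exec c st st' n -> frame c st st'.
Proof.
have subl (T : eqType) (s1 s2 : seq T) : {subset s1 <= s1 ++ s2}.
  by move=> x h; rewrite mem_cat h.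
have subr (T : eqType) (s1 s2 : seq T) : {subset s2 <= s1 ++ s2}.
  by move=> x h; rewrite mem_cat h orbT.
elim=> {c st st' n}
  [//|x e st|a e e' st|e st|e st|st|c1 c2 st st1 st2 n1 n2 _ f1 _ f2
  |e c1 c2 st st1 n _ _ f|e c1 c2 st st1 n _ _ f
  |e c st st1 st2 n1 n2 _ _ f1 _ f2|//].
- by split=> //= z; rewrite inE /upd => /negbTE->.
- by split=> //= z; rewrite inE /upd => /negbTE->.
- by split.
- by split.
- by split.
- apply: (@frame_trans _ _ st1).
    by apply: frame_sub f1 => //= /andP[].
  by apply: frame_sub f2 => //= /andP[].
- by apply: frame_sub f => //= /andP[].
- by apply: frame_sub f => //= /andP[].
exact: frame_trans f1 f2.
Qed.

(* The second argument of a postcondition is the number of steps left over. *)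
Definition wp (c : cmd) (Q : state -> nat -> Prop) (st : state) (n : nat) :=
  exists st' k, [/\ exec c st st' k, k <= n & Q st' (n - k)].

(** * Rules for total correctness with step credits *)

Section Rules.
Implicit Types (Q : state -> nat -> Prop) (st : state).

Lemma wp_frame c Q st n :
  wp c (fun st' n' => frame c st st' -> Q st' n') st n -> wp c Q st n.
Proof.
by move=> [st' [k [ex le h]]]; exists st', k; split=> //; apply/h/exec_frame/ex.
Qed.

Lemma wp_seq c1 c2 Q st n : wp c1 (wp c2 Q) st n -> wp (Seq c1 c2) Q st n.
Proof.
move=> [st1 [k1 [e1 l1 [st2 [k2 [e2 l2 h]]]]]]; exists st2, (k1 + k2).
by split; [apply: ExecSeq e1 e2|lia|rewrite subnDA].
Qed.

Lemma wp_skip Q st n : 0 < n -> Q st (n - 1) -> wp Skip Q st n.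
Proof. by exists st, 1; split=> //; constructor. Qed.

Lemma wp_assign x e Q st n :
  ecost e < n -> Q (set_reg st x (eval st e)) (n - (ecost e).+1) ->
  wp (Assign x e) Q st n.
Proof. by move=> le h; do 2 eexists; split; [constructor|exact: le|]. Qed.

Lemma wp_put a e e' Q st n :
  ecost e + ecost e' < n ->
  Q (set_arr st a (eval st e) (eval st e')) (n - (ecost e + ecost e').+1) ->
  wp (Put a e e') Q st n.
Proof. by move=> le h; do 2 eexists; split; [constructor|exact: le|]. Qed.

Lemma wp_send e Q st n :
  ecost e < n ->
  Q (set_out st (rcons (out st) (eval st e))) (n - (ecost e).+1) ->
  wp (Send e) Q st n.
Proof. by move=> le h; do 2 eexists; split; [constructor|exact: le|]. Qed.

Lemma wp_postall Q st n :
  0 < n -> Q (set_posts st xpredT) (n - 1) -> wp PostAll Q st n.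
Proof. by move=> le h; do 2 eexists; split; [constructor|exact: le|]. Qed.

Lemma wp_if e c1 c2 Q st n :
  ecost e < n ->
  (eval st e != 0 -> wp c1 Q st (n - (ecost e).+1)) ->
  (eval st e = 0 -> wp c2 Q st (n - (ecost e).+1)) ->
  wp (If e c1 c2) Q st n.
Proof.
move=> le h1 h2; case: (eqVneq (eval st e) 0) => h.
  have [st' [k [ex lk q]]] := h2 h.
  exists st', (ecost e + k).+1; split; [exact: ExecIfF|lia|].
  by rewrite -addSn subnDA.
have [st' [k [ex lk q]]] := h1 h.
exists st', (ecost e + k).+1; split; [exact: ExecIfT|lia|].
by rewrite -addSn subnDA.
Qed.

(* Termination comes for free: an iteration consumes at least one credit. *)
Lemma wp_while (I : state -> nat -> Prop) e c Q st0 n0 :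
  I st0 n0 ->
  (forall st n, frame c st0 st -> I st n -> ecost e < n) ->
  (forall st n, frame c st0 st -> I st n -> eval st e != 0 ->
     wp c I st (n - (ecost e).+1)) ->
  (forall st n, frame c st0 st -> I st n -> eval st e = 0 ->
     Q st (n - (ecost e).+1)) ->
  wp (While e c) Q st0 n0.
Proof.
move=> i0 le step stop.
have: frame c st0 st0 by exact: frame_refl.
(* Only the running state is generalised; the frame stays anchored at [st0]. *)
move: {1 3 4}st0 i0 => st; elim/ltn_ind: n0 st => n IH st i0 fr.
have ln := le _ _ fr i0.
case: (eqVneq (eval st e) 0) => h.
  exists st, (ecost e).+1; split; [exact: ExecWhileF|by []|exact: stop].
have [st1 [k1 [ex1 l1 i1]]] := step _ _ fr i0 h.
have [|st2 [k2 [ex2 l2 q]]] :=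
  IH _ _ st1 i1 (frame_trans fr (exec_frame ex1)); first lia.
exists st2, (ecost e + k1 + k2).+1; split.
- exact: ExecWhileT h ex1 ex2.
- lia.
by move: q; congr (Q _ _); lia.
Qed.

End Rules.

(** * Memory layout and linked adjacency lists *)

Notation a_head := 9 (only parsing).
Notation a_next := 10 (only parsing).
Notation a_seen := 11 (only parsing).
Notation a_stack := 12 (only parsing).
Notation a_mark := 13 (only parsing).
(** Arrays and registers have separate name spaces; both start at 9, above the input tables (0 to 7)
    and [reg_answer] (8). *)
Notation r_phase := 9 (only parsing).
Notation r_count := 10 (only parsing).
Notation r_tmp := 11 (only parsing).
Notation r_sp := 12 (only parsing).
Notation r_start := 13 (only parsing).
Notation r_stamp := 14 (only parsing).

Ltac wp_step :=
  first [ apply: wp_seq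
        | apply: wp_skip; [by rewrite /=; lia | rewrite /= /upd /=]
        | apply: wp_assign; [by rewrite /=; lia | rewrite /= /upd /=]
        | apply: wp_put; [by rewrite /=; lia | rewrite /= /upd /=]
        | apply: wp_send; [by rewrite /=; lia | rewrite /= /upd /=]
        | apply: wp_postall; [by rewrite /=; lia | rewrite /= /upd /=] ].

(** Both edge tables are measured by the one register [tab_sources], which is also the only length
    that [unpack] maintains when it refills them. *)
Definition graph_tab (st : state) (es : seq (nat * nat)) : Prop :=
  [/\ reg st tab_sources = size es,
      forall j, j < size es -> arr st tab_sources j = (nth (0, 0) es j).1
    & forall j, j < size es -> arr st tab_targets j = (nth (0, 0) es j).2].

Definition succs (es : seq (nat * nat)) (v : nat) : seq nat :=
  [seq p.2 | p <- es & p.1 == v].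

(* A pointer to the edge number j is stored as j.+1, and 0 is the null pointer. *)
Fixpoint chain (next target : nat -> nat) (k e : nat) (l : seq nat) : bool :=
  match l with
  | [::] => e == 0
  | w :: l' =>
      [&& 0 < e, e.-1 < k, target e.-1 == w & chain next target k (next e.-1) l']
  end.

(** All cells of the chain lie below [k], so writing the cell [k] leaves it intact. *)
Lemma chain_extend next target k e l x :
  chain next target k e l -> chain (upd next k x) target k.+1 e l.
Proof.
elim: l e => //= w l IH e /and4P[-> lt -> /IH h].
by rewrite /upd (ltn_eqF lt) -/(upd next k x) h ltnS ltnW.
Qed.

Lemma chain_nil next target k e l :
  chain next target k e l -> (e == 0) = (l == [::]).
Proof. by case: l => [|w l] //= /and4P[]; case: e. Qed.

(** The order is reversed because [build] inserts each edge at the head of its list. *)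
Definition linked (st : state) (es : seq (nat * nat)) : Prop :=
  forall v, chain (arr st a_next) (arr st tab_targets) (size es)
                  (arr st a_head v) (rev (succs es v)).

(* Turns the edge tables into one linked list of edges per source. *)
Definition build : cmd :=
  Seq (Assign r_count (Cst 0))
  (While (Lt (Reg r_count) (Reg tab_sources))
    (Seq (Put a_next (Reg r_count) (Get a_head (Get tab_sources (Reg r_count))))
    (Seq (Put a_head (Get tab_sources (Reg r_count)) (Inc (Reg r_count)))
         (Assign r_count (Inc (Reg r_count)))))).

Lemma build_ok es Q st n :
  (forall v, arr st a_head v = 0) -> graph_tab st es ->
  20 * size es + 10 <= n ->
  (forall st' n', frame build st st' -> linked st' es ->
     n <= n' + (20 * size es + 10) -> Q st' n') ->
  wp build Q st n.
Proof.
move=> head0 [sz src tgt] le post.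
(* An iteration with its test costs 17 steps; 20 are granted. *)
pose I st n' := exists j, [/\ reg st r_count = j, j <= size es,
  n <= n' + 20 * j + 5 &
  forall v, chain (arr st a_next) (arr st tab_targets) j (arr st a_head v)
                  (rev (succs (take j es) v))].
apply: wp_frame; wp_step; wp_step.
apply: (@wp_while I) => /=.
- exists 0; split=> //=; first lia.
  by move=> v; rewrite take0 head0.
- by move=> st1 n1 _ [j [_ lj ln _]]; lia.
- move=> st1 n1 [/= fr fa _ _] [j [ej lj ln ch]].
  rewrite ej fr // /upd /= sz.
  case lt: (j < size es) => // _.
  wp_step; wp_step; wp_step; wp_step; wp_step.
  exists j.+1; rewrite ej; split=> //; first lia.
  move=> v; have src1 : arr st1 tab_sources j = (nth (0, 0) es j).1.
    by rewrite fa ?src.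
  have tgt1 : arr st1 tab_targets j = (nth (0, 0) es j).2 by rewrite fa ?tgt.
  rewrite src1; set u := (nth _ es j).1; set st2 := set_reg _ _ _.
  rewrite -[arr st2 a_next]/(upd (arr st1 a_next) j (arr st1 a_head u)).
  rewrite -[arr st2 tab_targets]/(arr st1 tab_targets).
  rewrite -[arr st2 a_head]/(upd (arr st1 a_head) u j.+1).
  rewrite (take_nth (0, 0)) // /succs filter_rcons -/u eq_sym [upd _ u _ v]/upd.
  (* Only the list of the source [u] gains an element, at its head; every other list merely sees one
     more cell. *)
  case: eqVneq => [->|ne]; last exact/chain_extend/ch.
  rewrite map_rcons rev_rcons /= ltnSn tgt1 eqxx /= [upd _ j _ j]/upd eqxx.
  exact/chain_extend/ch.
move=> st1 n1 [/= fr fa _ _] [j [ej lj ln ch]].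
rewrite ej fr // /upd /= sz; case: ltnP => // ge _ fr'.
apply: post => //; last by lia.
have jE : j = size es by lia.
by move=> v; move: (ch v); rewrite (take_oversize ge) jE.
Qed.

(** * Reachability over edge lists *)

Definition reach (es : seq (nat * nat)) (u w : nat) : Prop :=
  exists2 p, path [rel a b | (a, b) \in es] u p & w = last u p.

Lemma reach_refl es u : reach es u u.
Proof. by exists [::]. Qed.

Lemma reach_step es u v w : reach es u v -> (v, w) \in es -> reach es u w.
Proof.
move=> [p pp ->] e; exists (rcons p w); last by rewrite last_rcons.
by rewrite rcons_path pp.
Qed.

Lemma reach_trans es u v w : reach es u v -> reach es v w -> reach es u w.
Proof.
move=> [p pp ->] [q qq ->]; exists (p ++ q); last by rewrite last_cat.
by rewrite cat_path pp.
Qed.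

(** Gives completeness of a search once its set of seen nodes is closed under edges. *)
Lemma reach_closed es (A : seq nat) u w :
  u \in A -> (forall a b, (a, b) \in es -> a \in A -> b \in A) ->
  reach es u w -> w \in A.
Proof.
move=> uA cl [p + ->]; elim: p u uA => //= v p IH u uA /andP[e].
exact/IH/cl/uA.
Qed.

Lemma mem_succs es v w : (w \in succs es v) = ((v, w) \in es).
Proof.
apply/mapP/idP => [[[a b] /=]|h]; last by exists (v, w); rewrite ?mem_filter ?eqxx.
by rewrite mem_filter /= => /andP[/eqP-> h] ->.
Qed.

(** * Depth-first search in linear time *)

Fixpoint stacked (next target : nat -> nat) (k : nat) (stk : nat -> nat)
    (sp : nat) (ls : seq (seq nat)) : bool :=
  match ls with
  | [::] => sp == 0
  | l :: ls' => [&& 0 < sp, chain next target k (stk sp.-1) l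
                  & stacked next target k stk sp.-1 ls']
  end.

Lemma upd_same (T : Type) (f : nat -> T) x y : upd f x y x = y.
Proof. by rewrite /upd eqxx. Qed.

Lemma upd_other (T : Type) (f : nat -> T) x y z : z != x -> upd f x y z = f z.
Proof. by rewrite /upd => /negbTE->. Qed.

Lemma stacked_upd next target k stk sp ls i x : sp <= i ->
  stacked next target k (upd stk i x) sp ls = stacked next target k stk sp ls.
Proof.
elim: ls sp => //= l ls IH sp le; case: posnP => //= sp0.
rewrite /upd ltn_eqF -/(upd stk i x); last lia.
by rewrite IH //; lia.
Qed.

(* Bounds the iterations that the search still needs when the nodes of A have
   been seen and ls lists the unexplored successors of the nodes on the stack. *)
Definition potential (es : seq (nat * nat)) (A : seq nat) (ls : seq (seq nat)) :=
  size ls + size (flatten ls) + count (fun e : nat * nat => e.1 \notin A) es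
  + count (fun e : nat * nat => e.2 \notin A) es.

(** Seeing [w] releases exactly its outgoing edges, which pay for its successor list on the
    stack. *)
Lemma count_source es (A : seq nat) w : w \notin A ->
  count (fun e : nat * nat => e.1 \notin A) es
  = size (succs es w) + count (fun e : nat * nat => e.1 \notin w :: A) es.
Proof.
move=> wA; rewrite /succs size_map size_filter.
elim: es => //= e es ->; rewrite inE negb_or.
by case: eqVneq => [->|_] /=; rewrite ?wA add0n ?addnA // [X in X + _]addnC.
Qed.

(** Bounds the number of pushes by edges rather than nodes: a newly seen node uses up at least the
    edge through which it was found. *)
Lemma count_target es (A : seq nat) v w : w \notin A -> (v, w) \in es ->
  count (fun e : nat * nat => e.2 \notin w :: A) es
  < count (fun e : nat * nat => e.2 \notin A) es.
Proof.
move=> wA; elim: es => //= e es IH; rewrite !inE negb_or => h.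
have: count (fun e : nat * nat => e.2 \notin w :: A) es
    <= count (fun e : nat * nat => e.2 \notin A) es.
  by apply: sub_count => x /=; rewrite inE negb_or => /andP[].
move: IH; move: (count _ es) (count _ es) => x y IH le.
case/orP: h => [/eqP<- /=|/IH lt]; first by rewrite eqxx wA ltnS.
by rewrite -addnS leq_add //; case: (e.2 \notin A); rewrite ?andbF ?leq_b1.
Qed.

(** The stack entry of [u] counts 1. The edges out of [u] are on the stack and the others in the
    source count, so each edge is counted once there, and at most once more as a target. *)
Lemma potential_init es u : potential es [:: u] [:: rev (succs es u)] <= 2 * size es + 1.
Proof.
rewrite /potential /= cats0 size_rev -addnA.
have := @count_source es [::] u isT; rewrite count_predT => ->.
have := count_size (fun e : nat * nat => e.2 \notin [:: u]) es.
have := @count_source es [::] u isT; rewrite count_predT => ->.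
by move: (size _) (count _ _) (count _ _) => x y z; lia.
Qed.

(** The new stack entry is paid by the edge into [w], the new list by the edges out of [w]; the
    strict decrease comes from taking [w] off the top list. *)
Lemma potential_push es (A : seq nat) l ls v w : w \notin A -> (v, w) \in es ->
  potential es (w :: A) (rev (succs es w) :: l :: ls) < potential es A ((w :: l) :: ls).
Proof.
move=> wA e; rewrite /potential /= !size_cat size_rev (count_source es wA).
have := count_target wA e.
move: (size (succs _ _)) (count _ _) (count _ _) (count _ _) => x y z t.
by lia.
Qed.

(* Depth-first search; the stack holds pointers into the adjacency lists of the
   nodes on the current path.  A node is seen when its entry equals the current
   stamp, so that no clearing is needed between searches. *)
Definition search : cmd :=
  Seq (Put a_seen (Reg r_start) (Reg r_stamp))
  (Seq (Put a_stack (Cst 0) (Get a_head (Reg r_start)))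
  (Seq (Assign r_sp (Cst 1))
  (While (Reg r_sp)
    (If (Get a_stack (Dec (Reg r_sp)))
      (Seq (Assign r_tmp (Dec (Get a_stack (Dec (Reg r_sp)))))
      (Seq (Put a_stack (Dec (Reg r_sp)) (Get a_next (Reg r_tmp)))
      (Seq (Assign r_tmp (Get tab_targets (Reg r_tmp)))
           (If (Eq (Get a_seen (Reg r_tmp)) (Reg r_stamp)) Skip
             (Seq (Put a_seen (Reg r_tmp) (Reg r_stamp))
             (Seq (Put a_stack (Reg r_sp) (Get a_head (Reg r_tmp)))
                  (Assign r_sp (Inc (Reg r_sp)))))))))
      (Assign r_sp (Dec (Reg r_sp))))))).

Lemma search_ok es Q st n :
  linked st es -> (forall v, arr st a_seen v != reg st r_stamp) ->
  40 * (2 * size es + 1) + 20 <= n ->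
  (forall st' n' (A : seq nat), frame search st st' ->
     (forall w, w \in A <-> reach es (reg st r_start) w) ->
     (forall w, arr st' a_seen w
        = if w \in A then reg st r_stamp else arr st a_seen w) ->
     n <= n' + (40 * (2 * size es + 1) + 20) -> Q st' n') ->
  wp search Q st n.
Proof.
move=> lk fresh le post.
set u := reg st r_start; set c := reg st r_stamp.
pose K := 40 * (2 * size es + 1).
(* [A] holds the seen nodes. It is closed under edges up to the successors waiting on the stack,
   hence closed once the stack is empty. Each unit of potential lost pays for 40 steps; the 12
   covers the initialisation. *)
pose I st' n' := exists A ls, [/\
  forall w, arr st' a_seen w = if w \in A then c else arr st a_seen w,
  stacked (arr st a_next) (arr st tab_targets) (size es) (arr st' a_stack)
    (reg st' r_sp) ls,
  u \in A,
  forall w, w \in A -> reach es u w &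
  [/\ forall w, w \in flatten ls -> exists2 a, a \in A & (a, w) \in es,
  forall a b, (a, b) \in es -> a \in A -> b \in A \/ b \in flatten ls &
  n + 40 * potential es A ls <= n' + K + 12]].
apply: wp_frame; do 6 wp_step.
apply: (@wp_while I) => /=.
- exists [:: u], [:: rev (succs es u)]; split=> /=.
  + by move=> w; rewrite inE.
  + by rewrite eqxx andbT; exact: lk.
  + by rewrite inE.
  + by move=> w; rewrite inE => /eqP->; exact: reach_refl.
  split=> [w|a b h|].
  + rewrite cats0 mem_rev mem_succs => h.
    by exists u => //; rewrite inE.
  + by rewrite inE => /eqP ea; right; rewrite cats0 mem_rev mem_succs -ea.
  by have := potential_init es u; rewrite /K; lia.
- by move=> st1 n1 _ [A [ls [_ _ _ _ [_ _ b]]]]; rewrite /K in b; lia.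
- move=> st1 n1 [/= fr fa _ _] [A [[|l ls] [sA sk uA rA [fl cl b]]]].
    by move/eqP: sk => ->.
  case/and3P: sk => sp0 cl1 sk _.
  set sp := reg st1 r_sp in sp0 cl1 sk.
  have rs : reg st1 r_stamp = c by rewrite fr.
  have nx : arr st1 a_next = arr st a_next by rewrite fa.
  have tg : arr st1 tab_targets = arr st tab_targets by rewrite fa.
  have hd : arr st1 a_head = arr st a_head by rewrite fa.
  (* A nonempty stack keeps the potential positive, so a whole iteration is affordable. *)
  have b2 : n <= n1 + K + 12 - 40 by move: b; rewrite /potential /=; lia.
  have n1b : 40 < n1 by rewrite /K in b2; lia.
  apply: wp_if => /=; first by lia.
    rewrite (chain_nil cl1); case: l cl1 fl cl b => //= w l.
    case/and4P=> e0 ek /eqP tw cl1 fl cl b _.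
    do 6 wp_step.
    rewrite nx tg tw.
    apply: wp_if => /=; first (by lia); rewrite /upd /= rs sA.
      (* Here [w] carries the current stamp. By [fresh] the stamp is not a leftover, so [w] was seen
         in this search and is just dropped from the top list. *)
      case: ifP => [wA _|_]; last by rewrite (negbTE (fresh w)).
      wp_step; exists A, (l :: ls); split=> //=.
        change (stacked (arr st a_next) (arr st tab_targets) (size es)
          (upd (arr st1 a_stack) sp.-1 (arr st a_next (arr st1 a_stack sp.-1).-1))
          sp (l :: ls)).
        by rewrite /= sp0 upd_same cl1 stacked_upd.
      split=> //.
      + by move=> x xl; apply: fl; rewrite inE xl orbT.
      + move=> x y e xA; have := cl x y e xA; rewrite inE.
        by case=> [|/orP[/eqP->|]]; [left|left|right].
      by move: b; rewrite /potential /=; lia.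
    (* Here [w] is new: it is stamped and its successor list pushed. *)
    case: ifP => [|/negbT wA _]; first by rewrite eqxx.
    do 5 wp_step.
    have [v vA e] := fl w (mem_head _ _).
    exists (w :: A), (rev (succs es w) :: l :: ls); split=> /=.
    + by move=> x; rewrite inE /upd /=; case: eqVneq => //= _; rewrite sA.
    + change (stacked (arr st a_next) (arr st tab_targets) (size es)
        (upd (upd (arr st1 a_stack) sp.-1 (arr st a_next (arr st1 a_stack sp.-1).-1))
             sp (arr st1 a_head w))
        sp.+1 (rev (succs es w) :: l :: ls)).
      rewrite [stacked _ _ _ _ _ _]/= upd_same hd lk sp0.
      rewrite upd_other ?upd_same ?cl1; last by lia.
      by rewrite !stacked_upd // leq_pred.
    + by rewrite inE uA orbT.
    + move=> x; rewrite inE => /orP[/eqP->|/rA//].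
      exact: reach_step (rA v vA) e.
    split.
    + move=> x; rewrite mem_cat mem_rev mem_succs => /orP[h|h].
        by exists w; rewrite ?mem_head.
      have [|a aA ea] := fl x; first by rewrite inE h orbT.
      by exists a => //; rewrite inE aA orbT.
    + move=> x y exy; rewrite !inE mem_cat mem_rev mem_succs.
      case/orP=> [/eqP<-|xA]; first by right; rewrite exy.
      case: (cl x y exy xA) => [->|]; first by left; rewrite orbT.
      rewrite inE => /orP[->|h]; first by left.
      by right; rewrite h orbT.
    have := potential_push l ls wA e; move: b.
    by move: (potential _ _ _) (potential _ _ _) => x y; lia.
  (* A null pointer on top: the exhausted list is popped. *)
  move/eqP; rewrite (chain_nil cl1) => /eqP l0; subst l.
  wp_step; exists A, ls; split=> //.
  by split=> //; move: b; rewrite /potential /=; lia.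
move=> st1 n1 [/= fr fa _ _] [A [[|l ls] [sA sk uA rA [_ cl b]]]] sp0 fr'; last first.
  by move: sk; rewrite /= sp0.
apply: (post _ _ A) => //.
- move=> w; split; first exact: rA.
  apply: reach_closed uA _ => x y e xA.
  by case: (cl x y e xA).
by rewrite /K in b; lia.
Qed.

(** * Tables, messages and the site program *)

Definition tab (st : state) (x : nat) (l : seq nat) : Prop :=
  reg st x = size l /\ forall j, j < size l -> arr st x j = nth 0 l j.

Lemma tab_append st x l y st' :
  tab st x l -> reg st' x = (reg st x).+1 ->
  arr st' x = upd (arr st x) (reg st x) y -> tab st' x (rcons l y).
Proof.
move=> [sz nt] er ea; split=> [|j]; rewrite size_rcons; first by rewrite er sz.
rewrite ea sz nth_rcons /upd ltnS leq_eqVlt; case: eqVneq => [->|_ /= lt].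
  by rewrite ltnn.
by rewrite lt nt.
Qed.

Lemma tab_same st x l st' :
  tab st x l -> reg st' x = reg st x -> arr st' x = arr st x -> tab st' x l.
Proof. by rewrite /tab => h -> ->. Qed.

Definition message (ps : seq (nat * nat)) : seq nat :=
  flatten [seq [:: p.1; p.2] | p <- ps].

Lemma message_cat ps qs : message (ps ++ qs) = message ps ++ message qs.
Proof. by rewrite /message map_cat flatten_cat. Qed.

Lemma size_message ps : size (message ps) = 2 * size ps.
Proof. by elim: ps => //= p ps; rewrite /message /= => ->; rewrite mulnS. Qed.

(** Marks turn membership among the sources into one array access, and merge [s] with an equal
    in-node. *)
Definition mark_table : cmd :=
  Seq (Assign r_count (Cst 0))
  (While (Lt (Reg r_count) (Reg tab_in))
    (Seq (Put a_mark (Get tab_in (Reg r_count)) (Cst 1))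
         (Assign r_count (Inc (Reg r_count))))).

Lemma mark_ok l Q st n :
  (forall v, arr st a_mark v = 0) -> tab st tab_in l ->
  20 * size l + 10 <= n ->
  (forall st' n', frame mark_table st st' ->
     (forall v, (arr st' a_mark v != 0) = (v \in l)) ->
     n <= n' + (20 * size l + 10) -> Q st' n') ->
  wp mark_table Q st n.
Proof.
move=> mark0 [sz nt] le post.
pose I st' n' := exists j, [/\ reg st' r_count = j, j <= size l,
  n <= n' + 20 * j + 5 &
  forall v, (arr st' a_mark v != 0) = (v \in take j l)].
apply: wp_frame; wp_step; wp_step.
apply: (@wp_while I) => /=.
- exists 0; split=> //=; first lia.
  by move=> v; rewrite take0 mark0.
- by move=> st1 n1 _ [j [_ lj ln _]]; lia.
- move=> st1 n1 [/= fr fa _ _] [j [ej lj ln ch]].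
  rewrite ej fr // /upd /= sz.
  case lt: (j < size l) => // _.
  do 3 wp_step.
  exists j.+1; split=> //=; [by rewrite upd_same ej | by lia |].
  move=> v; rewrite (take_nth 0) // mem_rcons inE -ch.
  by rewrite /upd /= ej (fa tab_in) // nt //; case: (v == _).
move=> st1 n1 [/= fr fa _ _] [j [ej lj ln ch]].
rewrite ej fr // /upd /= sz; case: ltnP => // ge _ fr'.
apply: post => //; last by lia.
by move=> v; rewrite ch take_oversize.
Qed.

Definition report : cmd :=
  Seq (Assign r_count (Cst 0))
  (While (Lt (Reg r_count) (Reg tab_virtual))
    (Seq (If (Eq (Get a_seen (Get tab_virtual (Reg r_count))) (Reg r_stamp))
           (Seq (Send (Reg r_start)) (Send (Get tab_virtual (Reg r_count))))
           Skip)
         (Assign r_count (Inc (Reg r_count))))).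

Lemma report_ok vs Q st n :
  tab st tab_virtual vs ->
  40 * size vs + 10 <= n ->
  (forall st' n', frame report st st' ->
     out st' = out st ++ message [seq (reg st r_start, v)
       | v <- vs & arr st a_seen v == reg st r_stamp] ->
     n <= n' + (40 * size vs + 10) -> Q st' n') ->
  wp report Q st n.
Proof.
move=> [sz nt] le post.
pose sel l := message [seq (reg st r_start, v)
       | v <- l & arr st a_seen v == reg st r_stamp].
pose I st' n' := exists j, [/\ reg st' r_count = j, j <= size vs,
  n <= n' + 40 * j + 5 & out st' = out st ++ sel (take j vs)].
apply: wp_frame; wp_step; wp_step.
apply: (@wp_while I) => /=.
- exists 0; split=> //=; first lia.
  by rewrite take0 cats0.
- by move=> st1 n1 _ [j [_ lj ln _]]; lia.
- move=> st1 n1 [/= fr fa _ _] [j [ej lj ln ch]].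
  rewrite ej fr // /upd /= sz.
  case lt: (j < size vs) => // _.
  have selS : sel (take j.+1 vs) = sel (take j vs)
      ++ (if arr st a_seen (nth 0 vs j) == reg st r_stamp
          then [:: reg st r_start; nth 0 vs j] else [::]).
    rewrite /sel (take_nth 0) // filter_rcons.
    by case: ifP; rewrite ?cats0 // map_rcons -cats1 message_cat.
  wp_step; apply: wp_if => /=; first by lia.
    rewrite ej !fa // fr // nt // /upd /= => h.
    do 4 wp_step.
    exists j.+1; split=> //=; [by rewrite upd_same ej | by lia |].
    rewrite selS ch fa // ej nt // fr // /upd /=.
    by move: h; case: (arr st _ _ == _) => // _; rewrite -!cats1 -!catA.
  rewrite ej !fa // fr // nt // /upd /= => h.
  do 2 wp_step.
  exists j.+1; split=> //=; [by rewrite upd_same ej | by lia |].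
  by rewrite selS ch; move: h; case: (arr st _ _ == _) => // _; rewrite cats0.
move=> st1 n1 [/= fr fa _ _] [j [ej lj ln ch]].
rewrite ej fr // /upd /= sz; case: ltnP => // ge _ fr'.
apply: post => //; last by lia.
by rewrite ch take_oversize.
Qed.

(** [r_stamp] is both loop counter and stamp. It is increased before the search, so stamps are
    positive and each exceeds those of all earlier searches. *)
Definition explore : cmd :=
  Seq (Assign r_stamp (Cst 0))
  (While (Lt (Reg r_stamp) (Reg tab_nodes))
    (Seq (Assign r_start (Get tab_nodes (Reg r_stamp)))
    (Seq (Assign r_stamp (Inc (Reg r_stamp)))
         (If (Get a_mark (Reg r_start)) (Seq search report) Skip)))).

(* Bounds one search through m edges followed by a scan of o targets. *)
Definition visit_cost (m o : nat) : nat := 80 * m + 40 * o + 100.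

Lemma explore_ok (ns srcs vs : seq nat) es (Q : state -> nat -> Prop) st n :
  tab st tab_nodes ns -> tab st tab_virtual vs -> linked st es ->
  (forall v, (arr st a_mark v != 0) = (v \in srcs)) ->
  (forall v, arr st a_seen v = 0) -> out st = [::] ->
  30 * size ns + visit_cost (size es) (size vs) * count (mem srcs) ns + 10 <= n ->
  (forall st' n' ps, out st' = message ps ->
     (forall u v, (u, v) \in ps
        <-> [/\ u \in ns, u \in srcs, v \in vs & reach es u v]) ->
     size ps <= count (mem srcs) ns * size vs -> Q st' n') ->
  wp explore Q st n.
Proof.
move=> [szn ntn] tv lk mk seen0 out0 le post.
(* For m edges and o targets, a search is charged 80m + 60 and a report 40o + 10; [T] covers both
   with 30 to spare. *)
set T := visit_cost _ _ in le.
(* [ps] collects the pairs sent for the first [j] nodes. As no stamp exceeds [j], the next one is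
   fresh. The last clause keeps [T] credits for each source still to come. *)
pose I st' n' := exists j ps, [/\ reg st' r_stamp = j, j <= size ns,
  forall w, arr st' a_seen w <= j, out st' = message ps &
  [/\ forall u v, (u, v) \in ps
        <-> [/\ u \in take j ns, u \in srcs, v \in vs & reach es u v],
      size ps <= count (mem srcs) (take j ns) * size vs &
      30 * (size ns - j) + T * count (mem srcs) (drop j ns) + 5 <= n']].
wp_step; wp_step.
apply: (@wp_while I) => /=.
- exists 0, [::]; split=> //=; first by move=> w; rewrite seen0.
  rewrite take0 drop0 subn0; split=> //; last by move: (T * _) le => x; lia.
  by move=> u v; split=> // -[].
- by move=> st1 n1 _ [j [ps [_ _ _ _ [_ _ b]]]]; move: (T * _) b => x; lia.
- move=> st1 n1 [/= fr fa _ _] [j [ps [ej lj sn ou [mem_ps sz b]]]].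
  rewrite ej fr // /upd /= szn; case lt: (j < size ns) => // _.
  set u := nth 0 ns j.
  have eu : arr st1 tab_nodes j = u by rewrite fa // ntn.
  have tk : take j.+1 ns = rcons (take j ns) u by rewrite (take_nth 0).
  have ct : count (mem srcs) (take j.+1 ns) = count (mem srcs) (take j ns) + (u \in srcs).
    by rewrite tk -cats1 count_cat /= addn0.
  have cd : count (mem srcs) (drop j ns)
      = (u \in srcs) + count (mem srcs) (drop j.+1 ns).
    by rewrite (drop_nth 0).
  have b' : 30 + 30 * (size ns - j.+1) + T * (u \in srcs)
      + T * count (mem srcs) (drop j.+1 ns) + 5 <= n1.
    by move: b; rewrite cd mulnDr; move: (T * _) (T * _) => x y; lia.
  do 4 wp_step; rewrite ej eu.
  apply: wp_if => /=; first by lia.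
    rewrite /upd /= (fa a_mark) // => h.
    have us : u \in srcs by rewrite -mk.
    rewrite us muln1 in b' ct; wp_step.
    apply: (@search_ok es).
    + by move=> v; rewrite /= (fa a_next) // (fa tab_targets) // (fa a_head).
    + by move=> v; rewrite /= /upd /= neq_ltn ltnS sn.
    + by move: b'; rewrite /T /visit_cost; move: (_ * count _ _) => x; lia.
    move=> st2 n2 A [/= fr2 fa2 fo2 _]; rewrite /upd /= => memA sn2 le2.
    apply: (@report_ok vs).
    + apply: tab_same tv _ _; first by rewrite fr2 // upd_other // upd_other // fr.
      by rewrite fa2 // fa.
    + by move: b'; rewrite /T /visit_cost; move: (_ * count _ _) => x; lia.
    move=> st3 n3 [/= fr3 fa3 _ _] ou3 le3.
    exists j.+1, (ps ++ [seq (u, v) | v <- vs & v \in A]); split.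
    + by rewrite fr3 // fr2.
    + by [].
    + move=> w; rewrite fa3 // sn2.
      by case: ifP => _; rewrite ?leqnn // ltnW ?ltnS.
    + rewrite message_cat ou3 fo2 // -ou; congr (_ ++ message _).
      rewrite fr2 //; congr [seq _ | _ <- _]; apply: eq_filter => v.
      rewrite fr2 // sn2; case: ifP => _; rewrite /upd /= ?eqxx //.
      by apply/negbTE; rewrite neq_ltn ltnS sn.
    split.
    + move=> v w; rewrite mem_cat tk mem_rcons inE; split.
        case/orP=> [/mem_ps[vn vs1 wv r]|]; first by split=> //; rewrite vn orbT.
        case/mapP=> x; rewrite mem_filter => /andP[xA xv] [-> ->].
        by rewrite eqxx us; split=> //; apply/memA.
      case=> /orP[/eqP->|vn] vs' wv r; apply/orP; last by left; apply/mem_ps.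
      right; apply/map_f; rewrite mem_filter wv andbT; exact/memA.
    + rewrite size_cat ct mulnDl mul1n leq_add // size_map size_filter.
      exact: count_size.
    by move: b'; rewrite /T /visit_cost; move: (_ * count _ _) => x; lia.
  rewrite /upd /= (fa a_mark) // => h.
  have us : u \in srcs = false by rewrite -mk h.
  rewrite us muln0 addn0 /= in b' ct; wp_step.
  exists j.+1, ps; split=> //.
  + by move=> w; apply: leq_trans (sn w) _.
  split=> //.
  + move=> v w; rewrite tk mem_rcons inE; split.
      by move/mem_ps=> [vn vs1 wv r]; split=> //; rewrite vn orbT.
    case=> /orP[/eqP->|vn] vs' wv r; last exact/mem_ps.
    by rewrite us in vs'.
  + by rewrite ct addn0.
  by move: b'; rewrite ?mulnBr; move: (T * _) => x; lia.
move=> st1 n1 [/= fr fa _ _] [j [ps [ej lj sn ou [mem_ps sz b]]]].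
rewrite ej fr // /upd /= szn; case: ltnP => // ge _.
move: mem_ps sz; rewrite take_oversize // => mem_ps sz.
exact: post ou mem_ps sz.
Qed.

(* First t is appended to the virtual nodes and s to the in-nodes.  As explore
   starts only from marked nodes of the site, s matters only where it is stored. *)
Definition site : cmd :=
  Seq (Put tab_virtual (Reg tab_virtual) (Get tab_query (Cst 1)))
  (Seq (Assign tab_virtual (Inc (Reg tab_virtual)))
  (Seq (Put tab_in (Reg tab_in) (Get tab_query (Cst 0)))
  (Seq (Assign tab_in (Inc (Reg tab_in)))
  (Seq mark_table (Seq build explore))))).

Definition site_cost (ns ins vs : seq nat) (es : seq (nat * nat)) (s : nat) : nat :=
  30 * size ns + 20 * size ins + 20 * size es
  + visit_cost (size es) (size vs).+1 * count (mem (rcons ins s)) ns + 100.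

(** Zero stands for the null pointer in [a_head], for the stamp of no search in [a_seen], and for an
    absent mark in [a_mark]. *)
Lemma site_ok (ns ins vs : seq nat) es s t (Q : state -> nat -> Prop) st :
  arr st tab_query 0 = s -> arr st tab_query 1 = t ->
  tab st tab_nodes ns -> tab st tab_in ins -> tab st tab_virtual vs ->
  graph_tab st es ->
  (forall a, a \in [:: a_head; a_seen; a_mark] -> forall v, arr st a v = 0) ->
  out st = [::] ->
  (forall st' n' ps, out st' = message ps ->
     (forall u v, (u, v) \in ps
        <-> [/\ u \in ns, u \in rcons ins s, v \in rcons vs t & reach es u v]) ->
     size ps <= count (mem (rcons ins s)) ns * (size vs).+1 -> Q st' n') ->
  wp site Q st (site_cost ns ins vs es s).
Proof.
move=> qs qt tn ti tv [gz gs gt] zero out0 post.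
set n := site_cost _ _ _ _ _.
set T := visit_cost (size es) (size vs).+1 * count (mem (rcons ins s)) ns.
have nE : n = 30 * size ns + 20 * size ins + 20 * size es + T + 100 by [].
clearbody n; do 8 wp_step; rewrite qs qt; set st1 := set_reg _ _ _.
wp_step; apply: (@mark_ok (rcons ins s)).
- exact: (zero a_mark).
- apply: tab_append ti _ _; first by [].
  by [].
- by rewrite size_rcons nE; lia.
rewrite size_rcons => st2 n2 [/= fr2 fa2 fo2 _] mk le2.
wp_step; apply: (@build_ok es).
- by move=> v; rewrite fa2 //=; exact: (zero a_head).
- by split; [rewrite fr2 | move=> j lt; rewrite fa2 //=; exact: gs
            | move=> j lt; rewrite fa2 //=; exact: gt].
- by lia.
move=> st3 n3 [/= fr3 fa3 fo3 _] lk le3.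
apply: (@explore_ok ns (rcons ins s) (rcons vs t) es) => //.
- by apply: tab_same tn _ _; rewrite ?fr3 ?fr2 ?fa3 ?fa2.
- have tv1 : tab st1 tab_virtual (rcons vs t) by apply: tab_append tv _ _.
  by apply: tab_same tv1 _ _; rewrite ?fr3 ?fr2 ?fa3 ?fa2.
- by move=> v; rewrite fa3.
- by move=> v; rewrite fa3 // fa2 //=; exact: (zero a_seen).
- by rewrite fo3 // fo2.
- by rewrite size_rcons -/T; lia.
by rewrite size_rcons.
Qed.

(** * The coordinator program *)

Definition unpack : cmd :=
  Seq (Assign r_count (Cst 0))
  (Seq (Assign tab_sources (Cst 0))
  (While (Lt (Reg r_count) (Reg tab_inbox))
    (Seq (Put tab_sources (Reg tab_sources) (Get tab_inbox (Reg r_count)))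
    (Seq (Assign r_count (Inc (Reg r_count)))
    (Seq (Put tab_targets (Reg tab_sources) (Get tab_inbox (Reg r_count)))
    (Seq (Assign r_count (Inc (Reg r_count)))
         (Assign tab_sources (Inc (Reg tab_sources))))))))).

Lemma nth_message ps j : j < size ps ->
  nth 0 (message ps) (2 * j) = (nth (0, 0) ps j).1 /\
  nth 0 (message ps) (2 * j).+1 = (nth (0, 0) ps j).2.
Proof.
elim: ps j => // p ps IH [|j] lt //.
by rewrite mulnS; apply: (IH j).
Qed.

(** The received pairs overwrite the edge tables of the fragment graph, so that [build] and [search]
    run unchanged on the graph of replies. *)
Lemma unpack_ok ps Q st n :
  tab st tab_inbox (message ps) -> 40 * size ps + 20 <= n ->
  (forall st' n', frame unpack st st' -> graph_tab st' ps ->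
     n <= n' + (40 * size ps + 20) -> Q st' n') ->
  wp unpack Q st n.
Proof.
move=> [sz nt] le post; rewrite size_message in sz nt.
pose I st' n' := exists j, [/\ reg st' r_count = 2 * j, reg st' tab_sources = j,
  j <= size ps, n <= n' + 40 * j + 10 &
  (forall i, i < j -> arr st' tab_sources i = (nth (0, 0) ps i).1) /\
  (forall i, i < j -> arr st' tab_targets i = (nth (0, 0) ps i).2)].
apply: wp_frame; do 4 wp_step.
apply: (@wp_while I) => /=.
- by exists 0; split=> //=; lia.
- by move=> st1 n1 _ [j [_ _ lj ln _]]; lia.
- move=> st1 n1 [/= fr fa _ _] [j [ec ej lj ln [ch1 ch2]]].
  rewrite ec fr // /upd /= sz ltn_mul2l /=.
  case lt: (j < size ps) => // _.
  have [m1 m2] := nth_message lt.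
  do 9 wp_step.
  exists j.+1; split=> //=.
  + by rewrite /upd /= ec mulnS.
  + by rewrite /upd /= ej.
  + by lia.
  split=> i; rewrite /upd /= ej ltnS leq_eqVlt; case: eqVneq => [-> _|_ /=].
  + by rewrite ec (fa tab_inbox) // nt ?m1 //; lia.
  + exact: ch1.
  + by rewrite ec (fa tab_inbox) // nt ?m2 //; lia.
  + exact: ch2.
move=> st1 n1 [/= fr fa _ _] [j [ec ej lj ln [ch1 ch2]]].
rewrite ec fr // /upd /= sz ltn_mul2l /=; case: ltnP => // ge _ fr'.
have jE : j = size ps by lia.
by apply: post => //; [split; rewrite -?jE | lia].
Qed.

Definition decide : cmd :=
  Seq unpack (Seq build
  (Seq (Assign r_start (Get tab_query (Cst 0)))
  (Seq (Assign r_stamp (Cst 1))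
  (Seq search
       (Assign reg_answer (Eq (Get a_seen (Get tab_query (Cst 1))) (Cst 1))))))).

Lemma decide_ok ps s t (Q : state -> nat -> Prop) st :
  arr st tab_query 0 = s -> arr st tab_query 1 = t ->
  tab st tab_inbox (message ps) ->
  (forall a, a \in [:: a_head; a_seen] -> forall v, arr st a v = 0) ->
  (forall st' n', frame decide st st' ->
     (reg st' reg_answer != 0 <-> reach ps s t) -> Q st' n') ->
  wp decide Q st (140 * size ps + 200).
Proof.
move=> qs qt ti zero post; apply: wp_frame.
(* Per pair, unpacking is charged 40, building 20 and searching 80, in total 140. *)
wp_step; apply: (unpack_ok ti); first by lia.
move=> st1 n1 [/= fr1 fa1 _ _] gr le1.
wp_step; apply: (build_ok _ gr); [|by lia|].
  by move=> v; rewrite fa1 //; exact: (zero a_head).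
move=> st2 n2 [/= fr2 fa2 _ _] lk le2.
do 4 wp_step; wp_step; apply: (@search_ok ps) => //.
- by move=> v; rewrite /= fa2 // fa1 // (zero a_seen).
- by lia.
move=> st3 n3 A [/= fr3 fa3 _ _]; rewrite /upd /= => memA sn le3.
wp_step=> fr; apply: post => //.
have q2 : arr st2 tab_query = arr st tab_query by rewrite fa2 // fa1.
rewrite /= upd_same (fa3 tab_query) // q2 qt sn (fa2 a_seen) // (fa1 a_seen) // (zero a_seen) //.
rewrite -qs -q2; split=> [|/memA->//].
by case: ifP => // /memA.
Qed.

(* The phase register is zero exactly in the first activation. *)
Definition coordinator : cmd :=
  If (Reg r_phase) decide (Seq (Assign r_phase (Cst 1)) PostAll).

(** * Correctness of the replies and size bounds *)

Section Correctness.
Variables (Sigma : Type) (G : graph Sigma) (F : fragmentation G).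
Implicit Types (i : 'I_(nfrag F)) (u v w s t : G).

Lemma nid_inj : injective (@nid Sigma G).
Proof. by move=> u v /ord_inj/enum_rank_inj. Qed.

Lemma mem_nodes_tab (A : {set G}) v : (nid v \in nodes_tab A) = (v \in A).
Proof. by rewrite mem_map ?mem_enum //; exact: nid_inj. Qed.

(** [sources_tab] and [targets_tab] enumerate the edges in the same order, so they can be read as
    one list of pairs. *)
Definition frag_list i : seq (nat * nat) :=
  [seq (nid e.1, nid e.2) | e <- enum (frag_edges i)].

Lemma mem_frag_list i u v :
  ((nid u, nid v) \in frag_list i) = ((u, v) \in frag_edges i).
Proof.
apply/mapP/idP => [[[x y]] + [/nid_inj-> /nid_inj->]|h]; first by rewrite mem_enum.
by exists (u, v) => //; rewrite mem_enum.
Qed.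

(** An edge from [part i] to a node outside it ends in a virtual node by definition, so inner and
    cross edges are together all edges with source in [part i]. *)
Lemma frag_edgesE i u v : ((u, v) \in frag_edges i) = (u \in part i) && edge u v.
Proof.
rewrite !inE /= -[(u, v) \in edges G]/(edge u v).
case: (boolP (u \in part i)) => ui; rewrite ?andbF //=.
case uv: (edge u v) => //=; case: (v \in part i) => //=.
by apply/existsP; exists u; rewrite ui.
Qed.

(** Each pair of [es] may stand for a whole path of [G], so this serves both for the edges of a
    fragment and for the pairs of the replies. *)
Lemma reach_connect (es : seq (nat * nat)) :
  (forall u b, (nid u, b) \in es ->
     exists2 v, b = nid v & connect (@edge Sigma G) u v) ->
  forall u (w : nat), reach es (nid u) w ->
  exists2 v, w = nid v & connect (@edge Sigma G) u v.
Proof.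
move=> sub u w [p pp ->]; elim: p u pp => [|b p IH] u /=; first by exists u.
case/andP=> /sub[v -> uv] /IH[x -> vx].
by exists x => //; exact: connect_trans uv vx.
Qed.

Lemma reach_frag i u (w : nat) : reach (frag_list i) (nid u) w ->
  exists2 v, w = nid v & connect (@edge Sigma G) u v.
Proof.
apply: reach_connect => {}u b /mapP[[x y]].
rewrite mem_enum frag_edgesE => /andP[_ e] [/nid_inj-> ->].
by exists y => //; exact: connect1.
Qed.

Definition is_reply s t i (ps : seq (nat * nat)) : Prop :=
  forall a b, (a, b) \in ps <->
    [/\ a \in nodes_tab (part i), a \in rcons (nodes_tab (in_nodes i)) (nid s),
        b \in rcons (nodes_tab (virtual_nodes i)) (nid t)
      & reach (frag_list i) a b].

Lemma in_some_part v : exists i, v \in part i.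
Proof.
have: v \in [set: G] by [].
by rewrite -(part_cover F) => /bigcupP[i _]; exists i.
Qed.

Section Replies.
Variables (s t : G) (ps : 'I_(nfrag F) -> seq (nat * nat)) (all : seq (nat * nat)).
Hypothesis replies : forall i, is_reply s t i (ps i).
Hypothesis mem_all : forall p, p \in all <-> exists i, p \in ps i.

(* A path is cut at the points where it leaves its current fragment: each of
   them is a virtual node of that fragment and an in-node of the next one. *)
Lemma path_reach u i x p :
  u \in part i -> nid u \in rcons (nodes_tab (in_nodes i)) (nid s) ->
  x \in part i -> reach (frag_list i) (nid u) (nid x) ->
  path (@edge Sigma G) x p -> t = last x p -> reach all (nid u) (nid t).
Proof.
(* [u] is the source of the current local piece and [x] the present position on the path. *)
elim: p u i x => [|y p IH] u i x ui us xi ux /=.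
  move=> _ tx; apply: reach_step (reach_refl _ _) _.
  apply/mem_all; exists i; apply/replies; split=> //; last by rewrite tx.
  - by rewrite mem_nodes_tab.
  by rewrite mem_rcons mem_head.
case/andP=> xy py ty.
(* Within the fragment the source stays and the local piece grows. *)
case yi: (y \in part i).
  apply: (IH u i y) => //; apply: reach_step ux _.
  by rewrite mem_frag_list frag_edgesE xi.
(* Otherwise the piece from [u] to [y] is a pair sent by site [i], and [y] becomes the source in its
   own fragment [j]. *)
have yv : y \in virtual_nodes i.
  by rewrite inE yi; apply/existsP; exists x; rewrite xi.
have [j yj] := in_some_part y.
have yin : y \in in_nodes j.
  rewrite inE yj; apply/existsP; exists i; apply/andP; split.
    by apply: contraFneq yi => ->.
  by apply/existsP; exists x; rewrite xi.
apply: (@reach_trans _ _ (nid y)); last first.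
  apply: (IH y j y) => //; last exact: reach_refl.
  by rewrite mem_rcons inE mem_nodes_tab yin orbT.
apply: reach_step (reach_refl _ _) _.
apply/mem_all; exists i; apply/replies; split=> //.
- by rewrite mem_nodes_tab.
- by rewrite mem_rcons inE mem_nodes_tab yv orbT.
apply: reach_step ux _.
by rewrite mem_frag_list frag_edgesE xi.
Qed.

Lemma replies_connect : reach all (nid s) (nid t) <-> connect (@edge Sigma G) s t.
Proof.
split.
  case/reach_connect=> [u b /mem_all[i /replies[_ _ _ /reach_frag//]]|v].
  by move/nid_inj->.
case/connectP=> p pp tp; have [i si] := in_some_part s.
apply: path_reach (si) _ si (reach_refl _ _) pp tp.
by rewrite mem_rcons mem_head.
Qed.

End Replies.

Definition num_sources s i : nat :=
  count (mem (rcons (nodes_tab (in_nodes i)) (nid s))) (nodes_tab (part i)).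

Lemma num_sources_le s i : num_sources s i <= #|part i :&: (s |: Vf F)|.
Proof.
rewrite /num_sources count_map -size_filter cardE.
apply: uniq_leq_size; first by rewrite filter_uniq // enum_uniq.
move=> v; rewrite mem_filter !mem_enum /= mem_rcons inE mem_nodes_tab.
case/andP=> h vi; rewrite !inE vi /=.
case/orP: h => [/eqP/nid_inj->|h]; first by rewrite eqxx.
by apply/orP; right; apply/bigcupP; exists i => //; rewrite inE h orbT.
Qed.

(** Double counting: as the parts are disjoint, each node of [X] counts for one [i] only. *)
Lemma sum_part_le (X : {set G}) : \sum_(i : 'I_(nfrag F)) #|part i :&: X| <= #|X|.
Proof.
have cardI i : #|part i :&: X| = \sum_(x in X) (x \in part i).
  rewrite -sum1_card [LHS]big_mkcond [RHS]big_mkcond; apply: eq_bigr => x _.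
  by rewrite in_setI; case: (x \in X); case: (x \in part i).
under eq_bigr => i _ do rewrite cardI.
rewrite exchange_big -sum1_card; apply: leq_sum => x _.
have [i xi] := in_some_part x.
rewrite (bigD1 i) //= xi big1 // => j ji.
by rewrite (disjointFl (part_disjoint ji) xi).
Qed.

(** There are at most |V_f| + 1 sources, and x + 1 <= 2 max(1, x). *)
Lemma sum_sources s : \sum_(i : 'I_(nfrag F)) num_sources s i <= 2 * maxn 1 #|Vf F|.
Proof.
apply: leq_trans (leq_sum _ (fun i _ => num_sources_le s i)) _.
by apply: leq_trans (sum_part_le _) _; rewrite cardsU1; case: (_ \notin _); lia.
Qed.

Lemma num_sources_bound s i : num_sources s i <= 2 * maxn 1 #|Vf F|.
Proof.
apply: leq_trans (sum_sources s).
by rewrite (bigD1 i) //= leq_addr.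
Qed.

Lemma virtual_Vf i : #|virtual_nodes i| <= #|Vf F|.
Proof.
apply/subset_leq_card/subsetP => v h.
by apply/bigcupP; exists i => //; rewrite inE h.
Qed.

Lemma frag_size_max i : frag_size i <= max_frag_size F.
Proof. exact: leq_bigmax. Qed.

Lemma part_le i : #|part i| <= frag_size i.
Proof. by apply: leq_trans (leq_addr _ _); rewrite subset_leq_card // subsetUl. Qed.

Lemma in_nodes_le i : #|in_nodes i| <= frag_size i.
Proof.
apply: leq_trans (part_le i); apply/subset_leq_card/subsetP => v.
by rewrite inE => /andP[].
Qed.

Lemma virtual_le i : #|virtual_nodes i| <= frag_size i.
Proof. by apply: leq_trans (leq_addr _ _); rewrite subset_leq_card // subsetUr. Qed.

(** Lets additive constants be absorbed into the fragment size. *)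
Lemma frag_size_gt0 i : 0 < frag_size i.
Proof. by apply: leq_trans (part_le i); rewrite card_gt0 part_neq0. Qed.

Lemma size_nodes_tab (A : {set G}) : size (nodes_tab A) = #|A|.
Proof. by rewrite size_map -cardE. Qed.

Lemma size_frag_list i : size (frag_list i) = #|frag_edges i|.
Proof. by rewrite size_map -cardE. Qed.

End Correctness.

(** * The complete run and its cost *)

Section Run.
Variables (Sigma : Type) (G : graph Sigma) (F : fragmentation G) (s t : G).
Implicit Types i : 'I_(nfrag F).

Definition site_start i : state :=
  receive [::] (set_tab tab_query (query_tab s t) (site_input i)).

Definition site_time i : nat :=
  site_cost (nodes_tab (part i)) (nodes_tab (in_nodes i))
            (nodes_tab (virtual_nodes i)) (frag_list i) (nid s).

(** State, step count and reply form one triple so that [fin_all_exists] can choose them for all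
    sites at once. *)
Lemma site_run i : exists r : state * nat * seq (nat * nat),
  [/\ exec site (site_start i) r.1.1 r.1.2, r.1.2 <= site_time i,
      out r.1.1 = message r.2, is_reply s t i r.2
    & size r.2 <= num_sources s i * #|virtual_nodes i|.+1].
Proof.
have: wp site (fun st' _ => exists ps, [/\ out st' = message ps, is_reply s t i ps
    & size ps <= num_sources s i * #|virtual_nodes i|.+1])
  (site_start i) (site_time i).
  apply: (@site_ok _ _ _ _ (nid s) (nid t)) => //.
  - split=> /=; rewrite /sources_tab /targets_tab.
    + by rewrite /upd /= !size_map.
    + move=> j; rewrite size_map => lt; rewrite /upd /= (nth_map (s, s)) //.
      by rewrite (nth_map (s, s)).
    + move=> j; rewrite size_map => lt; rewrite /upd /= (nth_map (s, s)) //.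
      by rewrite (nth_map (s, s)).
  - by move=> a; rewrite !inE => /or3P[] /eqP->.
  move=> st' _ ps ou mem_ps sz; exists ps; split=> //.
  by rewrite size_nodes_tab in sz.
case=> st' [k [ex le [ps [ou rp sz]]]].
by exists (st', k, ps).
Qed.

Lemma site_time_le i :
  site_time i <= 1000 * (maxn 1 #|Vf F| * max_frag_size F).
Proof.
rewrite /site_time /site_cost /visit_cost -/(num_sources s i).
rewrite !size_nodes_tab size_frag_list.
have w := num_sources_bound s i; have m := frag_size_max i.
have p := part_le i; have o := virtual_le i; have n := in_nodes_le i.
have z := frag_size_gt0 i.
have e : #|frag_edges i| <= frag_size i by rewrite leq_addl.
move: (frag_size i) m p o n z e => f m p o n z e.
(* The terms outside the searches sum to at most 30 + 20 + 20 + 100 = 170 times [f]; one search with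
   its report costs at most 80 + 40 + 40 + 100 = 260 times [f]. *)
apply: (@leq_trans (170 * f + (260 * f) * (2 * maxn 1 #|Vf F|))).
  have := @leq_mul (80 * #|frag_edges i| + 40 * (#|virtual_nodes i|.+1) + 100) _
           (260 * f) _ ltac:(lia) w.
  lia.
have : f * 1 <= max_frag_size F * maxn 1 #|Vf F| by rewrite leq_mul // leq_max.
have : f * maxn 1 #|Vf F| <= max_frag_size F * maxn 1 #|Vf F| by rewrite leq_mul.
by nia.
Qed.

End Run.

(* An empty fragment graph would make both bounds 0; there |V_f| is read as 1. *)
Theorem theorem1 :
  exists (A : algorithm) (Ct Cn : nat),
  forall (Sigma : Type) (G : graph Sigma) (F : fragmentation G) (s t : G),
  exists o : outcome (nfrag F),
    [/\ evaluates A s t o,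
        answer o = connect (@edge Sigma G) s t,
        time o <= Ct * (maxn 1 #|Vf F| * max_frag_size F),
        (forall i : 'I_(nfrag F), visits o i = 1)
      & traffic o <= Cn * maxn 1 #|Vf F| ^ 2].
Proof.
exists (Algorithm coordinator site), 3000, 8 => Sigma G F s t.
have /fin_all_exists[r rP] := @site_run _ _ F s t.
(* The fragment of [s] shows that [M] is positive and that some site is contacted. *)
have [i0 si0] := in_some_part F s.
set W := maxn 1 _; set M := max_frag_size F.
have M1 : 0 < M by apply: leq_trans (frag_size_gt0 i0) (frag_size_max i0).
have W1 : 0 < W by rewrite leq_max.
pose all := flatten [seq (r i).2 | i <- enum [set: 'I_(nfrag F)]].
have flat (T : Type) (f : 'I_(nfrag F) -> seq T) :
    size (flatten [seq f i | i <- enum [set: 'I_(nfrag F)]]) = \sum_i size (f i).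
  by rewrite size_flatten /shape -map_comp sumnE big_map big_enum /=; apply: eq_bigl => i; rewrite inE.
(* The number of pairs is bounded through [V], which is at most [W] for the traffic and at most [M]
   for the time. *)
pose V := \max_(i < nfrag F) #|virtual_nodes i|.
have size_all : size all <= 2 * W * V.+1.
  apply: leq_trans (leq_mul (sum_sources F s) (leqnn _)); rewrite /all flat.
  rewrite big_distrl /=; apply: leq_sum => i _.
  have [_ _ _ _ le] := rP i; apply: leq_trans le _.
  by rewrite leq_mul // ltnS (leq_bigmax (F := fun i => #|virtual_nodes i|)).
have maxW : V <= W.
  by apply/bigmax_leqP => i _; rewrite leq_max virtual_Vf orbT.
have maxM : V <= M.
  apply/bigmax_leqP => i _; exact: leq_trans (virtual_le i) (frag_size_max i).
pose st0 := coord_input F s t.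
pose st1 := set_posts (set_reg st0 r_phase 1) xpredT.
pose inbox := flatten [seq out (r i).1.1 | i <- enum [set: 'I_(nfrag F)]].
have inboxE : inbox = message all.
  rewrite /inbox /all; elim: (enum _) => //= i l ->.
  by have [_ _ -> _ _] := rP i; rewrite -message_cat.
have ex1 : exec coordinator st0 st1 (ecost (Reg r_phase) + (2 + 1)).+1.
  by apply: ExecIfF => //; apply: ExecSeq; [exact: ExecAssign | exact: ExecPostAll].
have mem_all p : p \in all <-> exists i, p \in (r i).2.
  split.
    by case/flattenP=> l /mapP[i _ ->] h; exists i.
  case=> i h; apply/flattenP; exists (r i).2 => //.
  by apply/mapP; exists i; rewrite ?mem_enum ?inE.
have reply_all i : is_reply s t i (r i).2 by have [_ _ _ h _] := rP i.
have conn := replies_connect reply_all mem_all.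
pose st2 := receive inbox st1.
have [st3 [k [ex2 lek [p3 ans]]]] : wp decide (fun st' _ => posts st' = posts st2 /\
    (reg st' reg_answer != 0 <-> reach all (nid s) (nid t))) st2 (140 * size all + 200).
  apply: decide_ok => //.
  - by rewrite /st2 inboxE; split=> // j _; exact: erefl.
  - by move=> a; rewrite !inE => /orP[] /eqP->.
  by move=> st' n' [_ _ _ pp] h; split=> //; exact: pp.
(* [r_phase] persists from the first activation, so the second one decides. *)
have ex3 : exec coordinator st2 st3 (ecost (Reg r_phase) + k).+1.
  exact: ExecIfT.
(* [receive] cleared the posts and [decide] makes none, so one round suffices. *)
have halt : run (Algorithm coordinator site) (query_tab s t) st2
    [ffun i => (r i).1.1]
    (@Outcome (nfrag F) (reg st3 reg_answer != 0) (ecost (Reg r_phase) + k).+1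
       [ffun=> 0] 0).
  apply: (@RunHalt (Algorithm coordinator site) _ _ _ _ st3 _ ex3).
  by apply/setP => i; rewrite !inE p3.
have round := @RunRound (Algorithm coordinator site) (nfrag F) (query_tab s t)
  st0 [ffun i => site_input i] st1 _ [set: 'I_(nfrag F)] [ffun i => (r i).1.1]
  [ffun i => (r i).1.2] _ ex1.
eexists; split.
- apply: round.
  + by apply/setP => i; rewrite !inE.
  + by apply/set0Pn; exists i0.
  + by move=> i _; rewrite !ffunE; have [h _ _ _ _] := rP i.
  + by move=> i; rewrite inE.
  under eq_map => i do rewrite ffunE.
  exact: halt.
- by apply/idP/idP => /=; [move/ans/conn | move/conn/ans].
- rewrite /=.
  have mx : \max_(i in [set: 'I_(nfrag F)]) [ffun i => (r i).1.2] i <= 1000 * (W * M).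
    apply/bigmax_leqP => i _; rewrite ffunE.
    by have [_ le _ _ _] := rP i; apply: leq_trans le (site_time_le s i).
  (* From 2W(V + 1) with V <= M and 1 <= M. *)
  have ba : size all <= 4 * (W * M).
    by apply: leq_trans size_all _; nia.
  have : 0 < W * M by rewrite muln_gt0 W1.
  by move: mx; move: (\max_(_ in _) _) (W * M) ba => x y ba; lia.
- by move=> i /=; rewrite !ffunE inE.
(* The coordinator's own message is empty; only the replies are traffic. *)
rewrite /= muln0 addn0 add0n.
have -> : \sum_(i in [set: 'I_(nfrag F)]) size (out ([ffun i => (r i).1.1] i)) = size inbox.
  by rewrite flat; apply: eq_big => i; rewrite ?inE ?ffunE.
rewrite inboxE size_message.
(* Each pair is two words, and 4W(W + 1) <= 8W^2 as W is positive. *)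
have : size all <= 2 * W * W.+1 by apply: leq_trans size_all _; rewrite leq_mul.
by nia.
Qed.
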